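(* Let $X$ be a topological space and let $\mathcal F$ be a family of nonempty subsets of $X$. (a) If $\lambda$ is a regular cardinal, then $X$ satisfies $\mathcal F$-$\mathrm{CAP}^*_\lambda$ if and only if $X$ satisfies $\mathcal F$-$\mathrm{CAP}_\lambda$. (b) If $\lambda$ is a singular cardinal, then $X$ satisfies $\mathcal F$-$\mathrm{CAP}^*_\lambda$ if and only if $X$ satisfies both $\mathcal F$-$\mathrm{CAP}_\lambda$ and $\mathcal F$-$\mathrm{CAP}_{\operatorname{cf}\lambda}$.
   Context: No separation axioms are assumed. Regular and singular cardinals are infinite. For an infinite cardinal $\lambda$ and a sequence $(Y_\alpha)_{\alpha\in\lambda}$ of subsets of $X$, a point $x\in X$ is a $\lambda$-complete accumulation point of the sequence if $|\{\alpha\in\lambda\mid Y_\alpha\cap U\neq\emptyset\}|=\lambda$ for every neighborhood $U$ of $x$ in $X$. $X$ satisfies $\mathcal F$-$\mathrm{CAP}^*_\lambda$ if every sequence $(F_\alpha)_{\alpha\in\lambda}$ of (not necessarily distinct) members of $\mathcal F$ has a $\lambda$-complete accumulation point in $X$. $X$ satisfies $\mathcal F$-$\mathrm{CAP}_\lambda$ if every sequence $(F_\alpha)_{\alpha\in\lambda}$ of pairwise distinct members of $\mathcal F$ has a $\lambda$-complete accumulation point in $X$. *)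

(* Defs.v *)
From mathcomp Require Import all_boot.
From mathcomp Require Import boolp classical_sets functions cardinality wochoice.
From mathcomp Require Import topology.

Set Implicit Arguments.
Unset Strict Implicit.
Unset Printing Implicit Defensive.

Local Open Scope classical_set_scope.
Local Open Scope card_scope.

Definition segment (T : Type) (R : rel T) (a : T) : set T :=
  [set x | ~~ R a x].

(* A cardinal is an initial ordinal: a well-ordered type that does not inject
   into any of its proper initial segments. *)
Record cardinal := Cardinal {
  cardinal_sort :> Type;
  cardinal_le : rel cardinal_sort;
  cardinal_wo : well_order cardinal_le;
  cardinal_initial : forall a : cardinal_sort,
    ~~ ([set: cardinal_sort] #<= segment cardinal_le a) }.

Definition infinite_cardinal (L : cardinal) : Prop := infinite_set [set: L].

Definition cardinal_lt (K L : cardinal) : Prop := ~~ ([set: L] #<= [set: K]).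

Definition has_cofinal_map (L : cardinal) (A : set L) : Prop :=
  exists f : L -> L, forall y : L, exists2 x, A x & cardinal_le y (f x).

(* The cofinality of L is the least ordinal admitting a cofinal map into L.
   The ordinals below L are its segments, and L itself is a candidate (by the
   identity map), so the least one is the intersection of all segments with a
   cofinal map, which is L if there are none. *)
Definition cofinality_set (L : cardinal) : set L :=
  [set x | forall a : L,
     has_cofinal_map (segment (@cardinal_le L) a) ->
     segment (@cardinal_le L) a x].

Arguments cofinality_set L : clear implicits.

Section Cofinality.
Variable L : cardinal.

Let R := @cardinal_le L.

Definition cofinality_le : rel (cofinality_set L) :=
  fun x y => R (\val x) (\val y).

Let R_min (A : set L) : A !=set0 -> exists2 z, A z & forall x, A x -> R z x.
Proof.
case=> x Ax.
have [|w [[/asboolP w1 w2] _]] := @cardinal_wo L [pred z | `[< A z >]].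
  by exists x; apply/asboolP.
by exists w => // z Az; apply: w2; apply/asboolP.
Qed.

Let R_refl z : R z z.
Proof. by have [|w -> H] := @R_min [set z]; [exists z|apply: H]. Qed.

Let R_antisym x y : R x y -> R y x -> x = y.
Proof.
move=> xy yx.
have [|w [_ wu]] := @cardinal_wo L [pred z | `[< z = x \/ z = y >]].
  by exists x; apply/asboolP; left.
rewrite -(wu x); last first.
  by split=> [|z /asboolP[]-> //]; apply/asboolP; left.
by apply: wu; split=> [|z /asboolP[]-> //]; apply/asboolP; right.
Qed.

Lemma cofinality_wo : well_order cofinality_le.
Proof.
apply: antisymmetric_well_order.
  by move=> x y /andP[xy yx]; apply: val_inj; apply: R_antisym.
move=> A [x Ax].
have [|w [u uA <-] wm] := @R_min [set \val u | u in [set u | u \in A]].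
  by exists (\val x), x.
by exists u; split=> // v vA; apply: wm; exists v.
Qed.

Lemma cofinality_initial (a : cofinality_set L) :
  ~~ ([set: cofinality_set L] #<= segment cofinality_le a).
Proof.
apply/negP => /card_leP[h].
set S := segment R (\val a).
pose g (x : cofinality_set L) : L :=
  \val (\val (h (SigSub (mem_set (I : [set: _] x))))).
have gS x : S (g x) by have := set_valP (h (SigSub (mem_set (I : [set: _] x)))).
have ginj : injective g.
  by move=> x y /val_inj/val_inj/inj; rewrite !inE => /(_ I I)/(congr1 \val).
have surjP (f : cofinality_set L -> L) :
    (forall y, exists x, R y (f x)) -> has_cofinal_map S.
  move=> fcof.
  exists (fun y => if pselect (exists x, g x = y) is left e
                   then f (projT1 (cid e)) else \val a) => y.
  have [x yfx] := fcof y; exists (g x) => //.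
  case: pselect => [e|[]]; last by exists x.
  by case: (cid e) => /= z /ginj ->.
have Sncof : ~ has_cofinal_map S.
  move=> Scof; have := set_valP a; move=> /(_ _ Scof)/negP.
  by apply; exact: R_refl.
case: (pselect (exists a, has_cofinal_map (segment R a))) => [ecof|ncof].
  have [b bcof bmin] := R_min ecof.
  case: (bcof) => f fcof; apply: Sncof.
  apply: (surjP (fun x => f (\val x))) => y.
  have [x xb yfx] := fcof y.
  have xC : x \in cofinality_set L.
    rewrite inE => c /bmin bc; apply/negP => cx; apply: (negP xb).
    have [|z zP zm] := @R_min [set z | [\/ z = b, z = c | z = x]].
      by exists b; constructor 1.
    have zb : R z b by apply: zm; constructor 1.
    have zc : R z c by apply: zm; constructor 2.
    have zx : R z x by apply: zm; constructor 3.
    case: zP => ?; subst z => //; last by rewrite (R_antisym zc cx).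
    by rewrite (R_antisym bc zb).
  by exists (SigSub xC).
apply: Sncof; apply: (surjP \val) => y.
have yC : y \in cofinality_set L.
  by rewrite inE => c ccof; case: ncof; exists c.
by exists (SigSub yC).
Qed.

Definition cofinality : cardinal := Cardinal cofinality_wo cofinality_initial.

End Cofinality.

Definition regular_cardinal (L : cardinal) : Prop :=
  infinite_cardinal L /\ [set: cofinality L] #= [set: L].

Definition singular_cardinal (L : cardinal) : Prop :=
  infinite_cardinal L /\ cardinal_lt (cofinality L) L.

Definition complete_accumulation_point (X : topologicalType) (L : cardinal)
    (Y : L -> set X) (x : X) : Prop :=
  forall U : set X, nbhs x U -> [set a | Y a `&` U !=set0] #= [set: L].

Definition CAPstar (X : topologicalType) (F : set (set X)) (L : cardinal) : Prop :=
  forall Y : L -> set X, (forall a, F (Y a)) ->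
    exists x : X, complete_accumulation_point Y x.

Definition CAP (X : topologicalType) (F : set (set X)) (L : cardinal) : Prop :=
  forall Y : L -> set X, (forall a, F (Y a)) -> injective Y ->
    exists x : X, complete_accumulation_point Y x.

(* Main.v *)
(** A sequence Y without complete accumulation point has all its fibers of size
    less than L (else the repeated set yields one, being nonempty), and so has
    its range (else apply CAP F L to distinct terms).  If L is regular this is
    impossible, for L would be a union of fewer than L bounded fibers.  If L is
    singular, the sizes of the fibers are cofinal in L, since otherwise L would
    inject into a square m * m with m < L; so cf L distinct terms can be chosen
    with fibers of sizes increasing to L, and CAP F (cf L) applied to them gives
    a complete accumulation point of Y.  Conversely, a sequence indexed by cf L
    is repeated along a cofinal map to get a sequence indexed by L. *)

Require Import Defs.
From mathcomp Require Import all_boot.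
From mathcomp Require Import boolp classical_sets functions cardinality wochoice.
From mathcomp Require Import topology.

Set Implicit Arguments.
Unset Strict Implicit.
Unset Printing Implicit Defensive.

Local Open Scope classical_set_scope.
Local Open Scope card_scope.

(** * Injections and comparison of cardinalities *)

Lemma inj_on_card_le T U (A : set T) (B : set U) (f : T -> U) :
  (forall x, A x -> B (f x)) ->
  (forall x y, A x -> A y -> f x = f y -> x = y) -> A #<= B.
Proof.
move=> fAB finj; have finj' : {in A &, injective f}.
  by move=> x y; rewrite !inE; apply: finj.
rewrite -(card_le_eql (inj_card_eq finj')); apply: subset_card_le.
by move=> _ [x /fAB ? <-].
Qed.

Lemma card_le_inj_on T U (A : set T) (B : set U) : A !=set0 -> A #<= B ->
  exists f : T -> U, (forall x, A x -> B (f x)) /\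
    (forall x y, A x -> A y -> f x = f y -> x = y).
Proof.
case=> a Aa /card_leP[h].
pose g x : U := if pselect (A x) is left Ax then \val (h (SigSub (mem_set Ax)))
                else \val (h (SigSub (mem_set Aa))).
exists g; split=> [x Ax|x y Ax Ay]; rewrite /g.
  by case: pselect => // ?; apply: set_valP.
case: pselect => // Ax'; case: pselect => // Ay'.
by move=> /val_inj/inj; rewrite !inE => /(_ I I)/(congr1 \val).
Qed.

Lemma card_leX T U T' U' (A : set T) (B : set U) (A' : set T') (B' : set U') :
  A #<= A' -> B #<= B' -> A `*` B #<= A' `*` B'.
Proof.
move=> AA' BB'; have [->|/set0P[[a b] [/= Aa Bb]]] := eqVneq (A `*` B) set0.
  exact: card_ge0.
have [f [fA finj]] := card_le_inj_on (ex_intro _ a Aa) AA'.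
have [g [gB ginj]] := card_le_inj_on (ex_intro _ b Bb) BB'.
apply: (@inj_on_card_le _ _ _ _ (fun z => (f z.1, g z.2))).
  by move=> [x y] [/= /fA ? /gB ?].
move=> [x y] [x' y'] [/= Ax By] [/= Ax' By'] [/finj -> // /ginj -> //].
Qed.

(** Send [A] to the pairs with second entry [a], and a new point [z] to [(a, b)] with [b] other than
    [a]. *)
Lemma card_leU1 T (A : set T) (z : T) :
  infinite_set A -> A `*` A #<= A -> z |` A #<= A.
Proof.
move=> A_inf /(card_le_trans _); apply.
have [a Aa] := infinite_setN0 A_inf.
have [b [Ab ba]] : A `\ a !=set0.
  by apply: infinite_setN0; exact: infinite_setD.
apply: (@inj_on_card_le _ _ _ _ (fun x => if pselect (A x) then (x, a) else (a, b))).
  by move=> x _; case: pselect.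
move=> x y xA yA; case: pselect => [Ax|nAx]; case: pselect => [Ay|nAy].
- by case.
- by case=> _ /esym.
- by case=> _.
- by move: xA yA => [|/nAx//] /= -> [|/nAy//] /= ->.
Qed.

(** * Injections built by well-founded recursion *)

Section WellFoundedTotal.
Variables (T : Type) (lt : T -> T -> Prop).
Hypothesis lt_min :
  forall A : set T, A !=set0 -> exists2 z, A z & forall x, A x -> ~ lt x z.
Hypothesis lt_tri : forall x y, [\/ x = y, lt x y | lt y x].

Lemma min_well_founded : well_founded lt.
Proof.
move=> x; apply: contrapT => nx.
have [|z nz zmin] := @lt_min [set x | ~ Acc lt x]; first by exists x.
apply: nz; constructor=> y yz; apply: contrapT => ny.
exact: zmin ny yz.
Qed.

(* Send each element, recursively, to one not yet used. *)
Lemma card_le_of_segments U (W : set T) (K : set U) :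
  (forall w, W w -> ~~ (K #<= W `&` [set x | lt x w])) -> W #<= K.
Proof.
move=> WK; have [->|/set0P[w0 Ww0]] := eqVneq W set0; first exact: card_ge0.
have [u0 Ku0] : K !=set0.
  by apply/set0P/negP => /eqP K0; have := WK _ Ww0; rewrite K0 card_ge0.
pose free w (f : forall x, lt x w -> U) u :=
  K u /\ forall x (xw : lt x w), W x -> f x xw <> u.
pose next w f := if pselect (exists u, @free w f u) is left e
                 then projT1 (cid e) else u0.
pose g := Fix min_well_founded (fun=> U) next.
have gE w : g w = next w (fun x _ => g x).
  rewrite {1}/g Fix_eq // => x f f' ff'; congr next.
  by apply: functional_extensionality_dep => y;
     apply: functional_extensionality_dep => ?.
have gfree w : W w -> K (g w) /\ forall x, lt x w -> W x -> g x <> g w.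
  move=> Ww; rewrite gE /next; case: pselect => [e|ne].
    by case: (cid e) => /= u [].
  (* If nothing were free, the values of [g] at predecessors of [w] would exhaust [K]. *)
  exfalso; have /negP := WK _ Ww; apply.
  apply: card_le_trans (card_image_le g _); apply: subset_card_le => u Ku.
  apply: contrapT => nu; apply: ne; exists u; split=> // x xw Wx gxu.
  by apply: nu; exists x.
apply: (@inj_on_card_le _ _ _ _ g) => [w /gfree[]//|x y Wx Wy gxy].
have [//|xy|yx] := lt_tri x y.
  by case: (gfree _ Wy) => _ /(_ _ xy Wx).
by case: (gfree _ Wx) => _ /(_ _ yx Wy); case; rewrite gxy.
Qed.

End WellFoundedTotal.

(** * Well-orders and their initial segments *)

Section WellOrder.
Variables (T : Type) (R : rel T).
Hypothesis R_wo : well_order R.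

Lemma well_order_min (A : set T) : A !=set0 ->
  exists2 z, A z & forall x, A x -> R z x.
Proof.
case=> x Ax.
have [|w [[/asboolP w1 w2] _]] := @R_wo [pred z | `[< A z >]].
  by exists x; apply/asboolP.
by exists w => // z Az; apply: w2; apply/asboolP.
Qed.

Lemma well_order_refl z : R z z.
Proof. by have [|w -> H] := @well_order_min [set z]; [exists z|apply: H]. Qed.

Lemma well_order_antisym x y : R x y -> R y x -> x = y.
Proof.
move=> xy yx.
have [|w [_ wu]] := @R_wo [pred z | `[< z = x \/ z = y >]].
  by exists x; apply/asboolP; left.
rewrite -(wu x); last first.
  by split=> [|z /asboolP[]-> //]; [apply/asboolP; left|exact: well_order_refl].
by apply: wu; split=> [|z /asboolP[]-> //];
  [apply/asboolP; right|exact: well_order_refl].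
Qed.

Lemma well_order_tri x y : [\/ x = y, ~~ R y x | ~~ R x y].
Proof.
have [xy|] := boolP (R x y); last by constructor 3.
have [yx|] := boolP (R y x); last by constructor 2.
by constructor 1; exact: well_order_antisym.
Qed.

Lemma well_order_ltW x y : ~~ R y x -> R x y.
Proof.
have [z [->|->] zmin nyx] := @well_order_min [set x; y] (ex_intro _ x (or_introl erefl)).
  by apply: zmin; right.
by rewrite zmin in nyx; last by left.
Qed.

(** If the least of [x], [y], [z] is not [x], antisymmetry merges it with the element before it. *)
Lemma well_order_trans y x z : R x y -> R y z -> R x z.
Proof.
have [|w wP wmin] := @well_order_min [set w | [\/ w = x, w = y | w = z]].
  by exists x; constructor 1.
have wx : R w x by apply: wmin; constructor 1.
have wy : R w y by apply: wmin; constructor 2.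
have wz : R w z by apply: wmin; constructor 3.
case: wP => ?; subst w => //.
  by move=> xy; rewrite (well_order_antisym xy wx).
by move=> xy yz; rewrite -(well_order_antisym yz wy).
Qed.

Lemma well_order_lt_min (A : set T) : A !=set0 ->
  exists2 z, A z & forall x, A x -> ~ segment R z x.
Proof.
by move=> /well_order_min[z Az zm]; exists z => // x /zm Rzx /negP.
Qed.

Lemma subset_segment x y : R x y -> segment R x `<=` segment R y.
Proof. by move=> xy z /= nxz; apply: contra nxz; apply: well_order_trans. Qed.

(** Otherwise no segment of [T] is large enough to exhaust [A], and recursion injects all of [T]
    into [A]. *)
Lemma not_card_le_segment U (A : set U) :
  ~~ ([set: T] #<= A) -> exists s, A #<= segment R s.
Proof.
move=> nTA; apply: contrapT => nex; move/negP: nTA; apply.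
apply: (card_le_of_segments (lt := fun x y => segment R y x)).
- exact: well_order_lt_min.
- exact: well_order_tri.
by move=> w _; apply/negP; rewrite setTI => Aw; apply: nex; exists w.
Qed.

End WellOrder.

(** * Squares of infinite initial segments *)

Section WellOrderCard.
Variables (T : Type) (R : rel T).
Hypothesis R_wo : well_order R.

(* Refining the order of the values of p by any well-order of S gives a
   well-order, in which the predecessors of w lie in [set x | R (p x) (p w)]. *)
Lemma card_le_of_preimages S U (W : set S) (p : S -> T) (K : set U) :
  (forall w, W w -> ~~ (K #<= W `&` [set x | R (p x) (p w)])) -> W #<= K.
Proof.
move=> WK; have [R0 R0_wo] := @well_ordering_principle {classic S}.
pose lt (x y : S) : Prop :=
  segment R (p y) (p x) \/ p x = p y /\ segment (R0 : rel S) y x.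
apply: (card_le_of_segments (lt := lt)).
- move=> A [x Ax].
  have [_ [y Ay <-] ymin] :=
    well_order_min R_wo (image_nonempty p (ex_intro _ x Ax)).
  have [|z [Az pzy] zmin] :=
    @well_order_min S R0 R0_wo (A `&` [set z | p z = p y]).
    by exists y.
  exists z => // t At; rewrite /lt /segment /= pzy => -[|[ptz]].
    by apply/negP; rewrite negbK; by apply: ymin; exists t.
  by apply/negP; rewrite negbK; apply: zmin; split=> //; rewrite /= ptz.
- move=> x y; rewrite /lt /segment /=.
  have [pxy|xy|yx] := well_order_tri R_wo (p x) (p y).
  + have [->|xy|yx] := @well_order_tri S R0 R0_wo x y.
    * by constructor 1.
    * by constructor 2; right.
    * by constructor 3; right.
  + by constructor 2; left.
  + by constructor 3; left.
move=> w Ww; apply: contra (WK _ Ww) => /card_le_trans; apply.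
apply: subset_card_le => x [Wx [xw|[pxw _]]]; split=> //=.
  exact: well_order_ltW R_wo _ _ xw.
by rewrite pxw; apply: well_order_refl.
Qed.

(** Hessenberg's argument, by induction on [m]. When no smaller segment is as large, pairs are
    ordered by their maximum: those with maximum at most [c] lie in the square of [segment R c] with
    [c] added, too small to contain a copy of [segment R m]. *)
Lemma segmentX_card_le m :
  infinite_set (segment R m) -> segment R m `*` segment R m #<= segment R m.
Proof.
have wf := min_well_founded (well_order_lt_min R_wo).
elim/(well_founded_ind wf): m => m IH m_inf.
have [[n nm mn]|m_init] :=
    pselect (exists2 n, segment R m n & segment R m #<= segment R n).
  have n_inf : infinite_set (segment R n).
    by move=> /(card_le_finite mn).
  apply: card_le_trans (card_leX mn mn) _.
  apply: card_le_trans (IH _ nm n_inf) _.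
  by apply/subset_card_le/(subset_segment R_wo)/(well_order_ltW R_wo).
pose p (z : T * T) := if R z.1 z.2 then z.2 else z.1.
have pP z c : R (p z) c -> R z.1 c /\ R z.2 c.
  rewrite /p; case: ifPn => [z12|/(well_order_ltW R_wo) z21] zc; split=> //;
  exact: well_order_trans R_wo _ _ _ _ zc.
apply: (card_le_of_preimages (p := p)) => w [/= w1 w2].
have mw : segment R m (p w) by rewrite /p; case: ifP.
apply/negP; set D := _ `&` _ => mD; apply: m_init; exists (p w) => //.
set c := p w in mw *.
apply: (card_le_trans mD).
have DE : D `<=` (c |` segment R c) `*` (c |` segment R c).
  have ltc x : R x c -> (c |` segment R c) x.
    move=> xc; have [->|xc'|cx] := well_order_tri R_wo x c; first by left.
      by right.
    by rewrite xc in cx.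
  by move=> z [_ /pP[/ltc ? /ltc ?]].
(* A finite square could not contain a copy of the infinite [segment R m]. *)
have c_inf : infinite_set (segment R c).
  move=> c_fin; apply: m_inf; apply: card_le_finite mD _.
  by apply: sub_finite_set DE _; apply: finite_setX; rewrite finite_setU; split.
have cc := IH _ mw c_inf.
have c1 := card_leU1 c c_inf cc.
apply: card_le_trans (subset_card_le DE) _.
exact: card_le_trans (card_leX c1 c1) cc.
Qed.

End WellOrderCard.

(** * Infinite cardinals and cofinality *)

Section Cardinal.
Variable L : cardinal.

Let R := @cardinal_le L.
Let R_wo := @cardinal_wo L.

(** A maximum [s] would make [L] its segment plus one point, which is no larger than the segment. *)
Lemma cardinal_no_max (s : L) : infinite_cardinal L -> exists y, ~~ R y s.
Proof.
move=> L_inf; apply: contrapT => s_max.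
have LU : [set: L] `<=` s |` segment R s.
  move=> x _; have [->|xs|sx] := well_order_tri R_wo x s; [by left|by right|].
  by case: s_max; exists x.
have s_inf : infinite_set (segment R s).
  by move=> fin_s; apply: L_inf; apply: sub_finite_set LU _; rewrite finite_setU.
have /negP := cardinal_initial s; apply.
apply: card_le_trans (subset_card_le LU) (card_leU1 _ s_inf _).
exact: segmentX_card_le.
Qed.

Lemma cofinality_cofinal_map :
  exists f : cofinality L -> L, forall y, exists c, R y (f c).
Proof.
have [[a0 a0P]|nocof] := pselect (exists a, has_cofinal_map (segment R a)).
  have [a [f fP] amin] := well_order_min R_wo
    (ex_intro _ a0 a0P : [set a | has_cofinal_map (segment R a)] !=set0).
  (* By minimality of [a], its segment lies in every segment that has a cofinal map. *)
  have aC x : segment R a x -> x \in cofinality_set L.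
    move=> xa; rewrite inE => b /amin ab.
    exact: (subset_segment R_wo ab).
  exists (fun c => f (\val c)) => y; have [x xa yx] := fP y.
  by exists (SigSub (aC x xa)).
exists (fun c => \val c) => y.
have yC : y \in cofinality_set L.
  by rewrite inE => b bP; case: nocof; exists b.
by exists (SigSub yC); apply: well_order_refl.
Qed.

(** Otherwise [A] embeds below some [s] in the cofinality; carrying [k] over gives a cofinal map on
    the segment of [s], which must then contain [s] itself. *)
Lemma cofinality_card_le T (A : set T) (k : T -> L) :
  (forall y, exists2 x, A x & R y (k x)) -> [set: cofinality L] #<= A.
Proof.
move=> kP; apply: contrapT => /negP nA.
have [s As] := not_card_le_segment (@cardinal_wo (cofinality L)) nA.
have [x0 Ax0 _] := kP (\val s).
have [i [iA iinj]] := card_le_inj_on (ex_intro _ x0 Ax0) As.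
suff sP : has_cofinal_map (segment R (\val s)).
  have := set_valP s; move=> /(_ _ sP)/negP; apply.
  exact: well_order_refl.
pose A' (z : L) x := A x /\ \val (i x) = z.
exists (fun z => if pselect (exists x, A' z x) is left e
                 then k (projT1 (cid e)) else z) => y.
have [x Ax yx] := kP y; exists (\val (i x)); first exact: iA.
case: pselect => [e|[]]; last by exists x.
by case: (cid e) => /= x' [Ax' /val_inj/iinj ->].
Qed.

Lemma bounded_of_not_card_le T (A : set T) (k : T -> L) :
  ~~ ([set: cofinality L] #<= A) -> exists y, forall x, A x -> segment R y (k x).
Proof.
move=> nA; apply: contrapT => nex; move/negP: nA; apply.
apply: (@cofinality_card_le _ _ k) => y; apply: contrapT => ny; apply: nex.
by exists y => x Ax; apply/negP => yx; apply: ny; exists x.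
Qed.

(* Keep the terms of k that are larger than all previous ones: they form a
   strictly increasing cofinal sequence, whose index set has the cardinality of
   the cofinality. *)
Lemma cofinal_subsequence (k : cofinality L -> L) :
  infinite_cardinal L -> (forall y, exists c, R y (k c)) ->
  exists e : cofinality L -> cofinality L, injective (k \o e) /\
    forall S, [set: cofinality L] #<= S ->
      forall y, exists2 c, S c & R y (k (e c)).
Proof.
move=> /infinite_setN0[y0 _] kcof.
set K := cofinality L; set Q := @cardinal_le K; have Q_wo := @cardinal_wo K.
pose C := [set c : K | forall d, segment Q c d -> segment R (k c) (k d)].
have Ccof y : exists2 c, C c & R y (k c).
  (* The first index whose term reaches [y] is in [C], since all earlier terms are below [y]. *)
  have [c yc cmin] := well_order_min Q_wo (kcof y : [set c | R y (k c)] !=set0).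
  exists c => // d dc; have ndy : segment R y (k d).
    by apply: contra dc; apply: cmin.
  exact: (subset_segment R_wo yc).
have KC : [set: K] #<= C := cofinality_card_le Ccof.
have K0 : [set: K] !=set0 by have [c _] := kcof y0; exists c.
have [e [eC einj]] := card_le_inj_on K0 KC.
have Cinj c d : C c -> C d -> k c = k d -> c = d.
  move=> Cc Cd cd; have [//|/Cd|/Cc] := well_order_tri Q_wo c d;
  by rewrite cd /segment /= well_order_refl.
exists e; split=> [c d /= kcd|S KS y].
  by apply: einj => //; apply: Cinj; [exact: eC|exact: eC|].
have [c Cc yc] := Ccof y.
(* [e] need not be monotone, but being injective it cannot squeeze [S] into the segment below
   [c]. *)
have [d Sd cd] : exists2 d, S d & Q c (e d).
  apply: contrapT => nex; have /negP := cardinal_initial c; apply.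
  apply: (card_le_trans KS).
  apply: (@inj_on_card_le _ _ _ _ e) => [x Sx|x z _ _]; last exact: einj.
  by apply/negP => cx; apply: nex; exists x.
exists d => //; have [->//|/negP//|edc] := well_order_tri Q_wo (e d) c.
apply: (well_order_trans R_wo yc); apply: (well_order_ltW R_wo).
exact: (eC d I) edc.
Qed.

End Cardinal.

(** * Complete accumulation points *)

Section CompleteAccumulation.
Variables (X : topologicalType) (F : set (set X)).

Lemma complete_accumulation_pointP (L : cardinal) (Y : L -> set X) x :
  (forall U, nbhs x U -> [set: L] #<= [set a | Y a `&` U !=set0]) ->
  complete_accumulation_point Y x.
Proof.
by move=> LY U xU; rewrite card_eq_le (subset_card_le (@subsetT _ _)) LY.
Qed.

Lemma accumulation_large_fiber (L : cardinal) (Y : L -> set X) (A : set X) :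
  A !=set0 -> [set: L] #<= Y @^-1` [set A] ->
  exists x, complete_accumulation_point Y x.
Proof.
move=> [x Ax] LA; exists x; apply: complete_accumulation_pointP => U xU.
apply: (card_le_trans LA); apply: subset_card_le => a /= ->.
by exists x; split=> //; apply: nbhs_singleton.
Qed.

(** Apply [CAP] to distinct terms [Y \o g]; since [g] is injective, their accumulation point serves
    for [Y]. *)
Lemma accumulation_large_range (L : cardinal) (Y : L -> set X) :
  CAP F L -> (forall a, F (Y a)) -> infinite_cardinal L ->
  [set: L] #<= range Y -> exists x, complete_accumulation_point Y x.
Proof.
move=> capL FY /infinite_setN0 L0 LY.
have [f [fY finj]] := card_le_inj_on L0 LY.
have [g gP] : {g : L -> L & forall a, Y (g a) = f a}.
  by apply: (@choice _ _ (fun a b => Y b = f a)) => a; have [b _ <-] := fY a I; exists b.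
have ginj : injective g by move=> a b gab; apply: finj => //; rewrite -!gP gab.
have [x xP] : exists x, complete_accumulation_point (Y \o g) x.
  apply: capL => [a|a b /=]; first exact: FY.
  by rewrite !gP => /finj; apply.
exists x; apply: complete_accumulation_pointP => U /xP; rewrite card_eq_le => /andP[_ LU].
apply: (card_le_trans LU); apply: (@inj_on_card_le _ _ _ _ g) => // a b _ _.
exact: ginj.
Qed.

Lemma CAPstar_CAP (L : cardinal) : CAPstar F L -> CAP F L.
Proof. by move=> H Y FY _; apply: H. Qed.

(* Repeat Y c on a set of indices bounded by the c-th term of a cofinal map. *)
Lemma CAPstar_cofinality (L : cardinal) :
  CAPstar F L -> CAPstar F (cofinality L).
Proof.
move=> capL Y FY; have [f fcof] := cofinality_cofinal_map L.
have [g gP] := choice fcof.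
have [x xP] := capL (Y \o g) (fun a => FY (g a)).
exists x; apply: complete_accumulation_pointP => U /xP; rewrite card_eq_le => /andP[_ LU].
(* If few [Y c] meet [U], their [f c] stay below some [y], and so does each [a] with [Y (g a)]
   meeting [U], being at most [f (g a)]. *)
apply: contrapT => /negP /(bounded_of_not_card_le f) [y yP].
have /negP := cardinal_initial y; apply.
apply: (card_le_trans LU); apply: subset_card_le => a /= /yP.
apply: contra => ya; exact: (well_order_trans (@cardinal_wo L) ya).
Qed.

Hypothesis F_nonempty : forall A : set X, F A -> A !=set0.

Lemma regular_CAP_CAPstar (L : cardinal) :
  regular_cardinal L -> CAP F L -> CAPstar F L.
Proof.
move=> [L_inf]; rewrite card_eq_le => /andP[_ LK] capL Y FY.
apply: contrapT => nacc.
have small_range : ~ ([set: L] #<= range Y).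
  by move=> /(accumulation_large_range capL FY L_inf).
have small_fiber a : ~ ([set: L] #<= Y @^-1` [set Y a]).
  by move=> /(accumulation_large_fiber (F_nonempty (FY a))).
(* A fiber is smaller than the cofinality, hence bounded; a set that is not a term gets an arbitrary
   bound. *)
have hP (A : set X) : exists y, forall a, Y a = A -> segment (@cardinal_le L) y a.
  have [[a <-]|nA] := pselect (exists a, Y a = A).
    apply: (@bounded_of_not_card_le L _ (Y @^-1` [set Y a]) id); apply/negP => KA.
    exact/(small_fiber a)/(card_le_trans LK).
  by have [y _] := infinite_setN0 L_inf; exists y => a Ya; case: nA; exists a.
have [h hY] := choice hP.
(* Each [y] lies in the fiber over [Y y], hence below [h (Y y)]: [h] is cofinal on the range. *)
apply/small_range/(card_le_trans LK)/(@cofinality_card_le L _ _ h) => y.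
by exists (Y y); [exists y|apply: (well_order_ltW (@cardinal_wo L)); apply: hY].
Qed.

Lemma CAP_cofinality_CAPstar (L : cardinal) : infinite_cardinal L ->
  CAP F L -> CAP F (cofinality L) -> CAPstar F L.
Proof.
move=> L_inf capL capK Y FY; set R := @cardinal_le L.
have R_wo : well_order R := @cardinal_wo L.
apply: contrapT => nacc.
have small_range : ~~ ([set: L] #<= range Y).
  by apply/negP => /(accumulation_large_range capL FY L_inf).
have small_fiber a : ~~ ([set: L] #<= Y @^-1` [set Y a]).
  by apply/negP => /(accumulation_large_fiber (F_nonempty (FY a))).
(* [h a] encodes the size of the fiber through [a], as the least index whose segment the fiber
   embeds in. *)
have [h hP] : {h : L -> L & forall a, Y @^-1` [set Y a] #<= segment R (h a) /\
    forall s, Y @^-1` [set Y a] #<= segment R s -> R (h a) s}.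
  apply: (@choice _ _ (fun a t => Y @^-1` [set Y a] #<= segment R t /\
    forall s, Y @^-1` [set Y a] #<= segment R s -> R t s)) => a.
  have [s0 s0P] := not_card_le_segment R_wo (small_fiber a).
  have [s sP smin] := well_order_min R_wo
    (ex_intro _ s0 s0P : [set s | Y @^-1` [set Y a] #<= segment R s] !=set0).
  by exists s.
(* Otherwise L would be a union of at most t sets of size at most y. *)
have hcof y : exists a, R y (h a).
  apply: contrapT => nex.
  have [t tP] := not_card_le_segment R_wo small_range.
  (* The larger of [y] and [t] bounds both the number of fibers and the size of each. *)
  have [m [ym tm]] : exists m, R y m /\ R t m.
    have [->|ty|yt] := well_order_tri R_wo y t.
    - by exists t; split; apply: well_order_refl.
    - by exists t; split; [apply: (well_order_ltW R_wo)|apply: well_order_refl].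
    - by exists y; split; [apply: well_order_refl|apply: (well_order_ltW R_wo)].
  have rangem := card_le_trans tP (subset_card_le (subset_segment R_wo tm)).
  have fiberm a : Y @^-1` [set Y a] #<= segment R m.
    apply: card_le_trans (proj1 (hP a)) _; apply: subset_card_le.
    apply: (subset_segment R_wo); apply: (well_order_trans R_wo _ ym).
    by apply: (well_order_ltW R_wo); apply/negP => ya; apply: nex; exists a.
  suff LX : [set: L] #<= segment R m `*` segment R m.
    have /negP := cardinal_initial m; apply; apply: (card_le_trans LX).
    apply: (segmentX_card_le R_wo) => m_fin; apply: L_inf.
    by apply: (card_le_finite LX); exact: finite_setX.
  have [y0 _] := infinite_setN0 L_inf.
  have [j [jm jinj]] := card_le_inj_on (ex_intro _ (Y y0) (imageT Y y0)) rangem.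
  have iE (A : set X) : exists i : L -> L, forall a, Y a = A ->
      segment R m (i a) /\ forall b, Y b = A -> i a = i b -> a = b.
    have [[a <-]|nA] := pselect (exists a, Y a = A).
      have [i [im iinj]] :=
        card_le_inj_on (ex_intro _ a erefl : Y @^-1` [set Y a] !=set0) (fiberm a).
      exists i => b bE; split; first exact: im.
      by move=> c cE; apply: iinj.
    by exists id => a Ya; case: nA; exists a.
  have [i iP] := choice iE.
  (* An index is determined by its fiber and its place in that fiber. *)
  apply: (@inj_on_card_le _ _ _ _ (fun a => (j (Y a), i (Y a) a))).
    by move=> a _; split=> /=; [exact/jm/imageT|have [] := iP (Y a) a erefl].
  move=> a b _ _ [/jinj Yab iab].
  have {}Yab : Y a = Y b by apply: Yab; exact: imageT.
  have [_] := iP (Y a) a erefl; apply; first by [].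
  by rewrite iab Yab.
have [f fcof] := cofinality_cofinal_map L.
have [g gP] := choice hcof.
(* The chosen fibers have pairwise different sizes, which stay cofinal along any set of as many
   indices as the cofinality. *)
have [|e [einj eP]] := @cofinal_subsequence L (fun c => h (g (f c))) L_inf.
  move=> y; have [c yc] := fcof y; exists c.
  exact: (well_order_trans R_wo yc).
pose A c := Y (g (f (e c))).
have [|c d Acd|x xP] := capK A; first by move=> c; exact: FY.
  (* Equal sets have the same fiber, so the two least indices agree. *)
  apply: einj => /=; apply: (well_order_antisym R_wo).
    by apply: (proj2 (hP _)); rewrite [Y _]Acd; apply: (proj1 (hP _)).
  by apply: (proj2 (hP _)); rewrite -[Y _]Acd; apply: (proj1 (hP _)).
apply: nacc; exists x; apply: complete_accumulation_pointP => U /xP.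
rewrite card_eq_le => /andP[_ /eP KU]; apply: contrapT => /negP.
(* If the indices of terms meeting [U] fit in the segment of [s], so does the fiber of each [A c]
   meeting [U]; then [s] bounds a cofinal set of sizes and is a maximum of [L]. *)
move=> /(not_card_le_segment R_wo)[s sP].
have [y /negP sy] := cardinal_no_max s L_inf.
have [c cU yc] := KU y; apply: sy; apply: (well_order_trans R_wo yc).
apply: (proj2 (hP _)); apply: card_le_trans sP; apply: subset_card_le.
by move=> a /= ->.
Qed.

End CompleteAccumulation.

Theorem proposition3p3 (X : topologicalType) (F : set (set X))
    (F_nonempty : forall A : set X, F A -> A !=set0) :
  (forall L : cardinal, regular_cardinal L ->
     (CAPstar F L <-> CAP F L)) /\
  (forall L : cardinal, singular_cardinal L ->
     (CAPstar F L <-> (CAP F L /\ CAP F (cofinality L)))).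
Proof.
split=> L L_card.
  by split; [exact: CAPstar_CAP|exact: regular_CAP_CAPstar].
split=> [capL|[]].
  by split; [exact: CAPstar_CAP|exact/CAPstar_CAP/CAPstar_cofinality].
by have [L_inf _] := L_card; exact: CAP_cofinality_CAPstar.
Qed.
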